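(* Let $p>3$ be a prime. Then \[ \sum_{k=1}^{p-1}k^2H_k^2\equiv\frac{79}{108}p-\frac{4}{9}\pmod{p^2},\qquad \sum_{k=1}^{p-1}k^3H_k^2\equiv-\frac{59}{144}p+\frac{1}{6}\pmod{p^2}. \] Moreover, for every integer $m$ with $0<m<p-1$: if $m$ is odd and $m\neq3$, then $\sum_{k=1}^{p-1}k^mH_k^2\equiv B_{m-1}+p\mu_m\pmod{p^2}$; if $m$ is even and $m\ne 2$, then $\sum_{k=1}^{p-1}k^mH_k^2\equiv \nu_m+p\lambda_m\pmod{p^2}$, where \[ \mu_m=-\frac{m+2}{2m}S(m-1)+\frac{1}{4}\sum_{r=0}^{m-1}B_rB_{m-1-r},\qquad \nu_m=-\frac{2}{m+1}S(m), \] \[ \lambda_m=\frac{2}{m+1}\sum_{r=0}^{m}\frac{\binom{m+1}{r}}{m+1-r}B_rS(m-r)-\frac{m^2-m+6}{12}B_{m-2}, \] and $S(n)=\sum_{r=0}^{n}\binom{n+1}{r}B_rB_{n-r}$.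
   Context: $H_n=\sum_{i=1}^n 1/i$ are the harmonic numbers. $B_0,B_1,B_2,\dots$ are the Bernoulli numbers defined by $B_0=1$ and $\sum_{k=0}^n\binom{n+1}{k}B_k=0$ for $n\ge1$ (so $B_1=-1/2$). For rationals $a,b$ whose denominators are coprime to $p$, $a\equiv b\pmod{p^e}$ means that $a-b$, written in lowest terms, has numerator divisible by $p^e$. *)

(* Defs.v *)
From HB Require Import structures.
From mathcomp Require Import all_boot all_order all_algebra.

Set Implicit Arguments.
Unset Strict Implicit.
Unset Printing Implicit Defensive.

Import Order.TTheory GRing.Theory Num.Theory.

Local Open Scope ring_scope.

Definition harmonic (n : nat) : rat := \sum_(1 <= i < n.+1) i%:R^-1.

(* The sequence B_0, ..., B_n, obtained by solving
   \sum_(k <= n) 'C(n + 1, k) B_k = 0 for B_n, whose coefficient is n + 1. *)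
Fixpoint bernoulli_seq (n : nat) : seq rat :=
  if n is n'.+1 then
    let s := bernoulli_seq n' in
    rcons s (- (\sum_(0 <= k < n) 'C(n.+1, k)%:R * s`_k) / n.+1%:R)
  else [:: 1].

Definition bernoulli (n : nat) : rat := (bernoulli_seq n)`_n.

Lemma size_bernoulli_seq n : size (bernoulli_seq n) = n.+1.
Proof. by elim: n => //= n IHn; rewrite size_rcons IHn. Qed.

Lemma nth_bernoulli_seq n k :
  (k <= n)%N -> (bernoulli_seq n)`_k = bernoulli k.
Proof.
elim: n => [|n IHn]; first by rewrite leqn0 => /eqP ->.
rewrite leq_eqVlt => /predU1P [-> //|]; rewrite ltnS => le_kn.
by rewrite /= nth_rcons size_bernoulli_seq ltnS le_kn IHn.
Qed.

Lemma bernoulli0 : bernoulli 0 = 1.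
Proof. by []. Qed.

Lemma bernoulli_rec n :
  (0 < n)%N -> \sum_(0 <= k < n.+1) 'C(n.+1, k)%:R * bernoulli k = 0.
Proof.
case: n => // n _; rewrite big_nat_recr //= binSn {2}/bernoulli /=.
rewrite nth_rcons size_bernoulli_seq ltnn eqxx mulrCA divff ?pnatr_eq0 // mulr1.
apply/eqP; rewrite subr_eq0; apply/eqP; apply: eq_big_nat => k /andP [_ lt_kn].
by rewrite nth_bernoulli_seq.
Qed.

(* a = b (mod p ^ e) in the local ring Z_(p); it includes the requirement
   that the denominators of a and b be coprime to p. *)
Definition eqmodr (p e : nat) (a b : rat) : bool :=
  [&& coprimez p (denq a), coprimez p (denq b)
    & ((p ^ e)%N %| numq (a - b))%Z].

Definition S_sum (n : nat) : rat :=
  \sum_(0 <= r < n.+1) 'C(n.+1, r)%:R * bernoulli r * bernoulli (n - r).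

Definition mu (m : nat) : rat :=
  - ((m%:R + 2) / (2 * m%:R)) * S_sum (m - 1)
  + 1 / 4 * \sum_(0 <= r < m) bernoulli r * bernoulli (m - 1 - r).

Definition nu (m : nat) : rat := - (2 / (m%:R + 1)) * S_sum m.

(* Only used for m >= 2, where the truncated subtraction m - 2 is exact. *)
Definition lambda (m : nat) : rat :=
  2 / (m%:R + 1)
    * \sum_(0 <= r < m.+1)
        'C(m.+1, r)%:R / (m.+1 - r)%:R * bernoulli r * S_sum (m - r)
  - (m%:R ^+ 2 - m%:R + 6) / 12 * bernoulli (m - 2).

(* Main.v *)
(* Write F_m(n) = 0^m + 1^m + ... + (n-1)^m, a polynomial in n whose coefficients
   are p-integral multiples of B_0, ..., B_m when m < p - 1.  Summation by parts
   together with Wolstenholme's congruence H_{p-1} = 0 (mod p^2) gives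
     \sum_k k^m H_k^2 = - \sum_k F_m(k) (2 H_k / k - 1 / k^2)   (mod p^2),
   and a second summation by parts reduces the moments \sum_k k^j H_k to power
   sums, for which \sum_k k^i = p B_i - [i = 0] (mod p^2).  This yields one
   closed form valid for all 0 < m < p - 1.  Since B_r = 0 for odd r > 1, most of
   its terms vanish according to the parity of m; for odd m what remains is
   Matiyasevich's identity relating \sum_k B_k B_{n-k} and
   \sum_k C(n+2, k) B_k B_{n-k}, whose polynomial form follows from the fact
   that a sequence of polynomials with D_{n+1}' proportional to D_n and
   D_{n+1}(1) = D_{n+1}(0) vanishes as soon as D_0 does. *)

From HB Require Import structures.
Require Import Defs.
From mathcomp Require Import all_boot all_order all_algebra.
From mathcomp Require Import ring lra zify.

Import GRing.Theory Num.Theory.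
Local Open Scope ring_scope.

(** * Bernoulli polynomials *)

Lemma deriv_eq0_rat (q : {poly rat}) : q^`() = 0 -> q = (q.[0])%:P.
Proof.
move=> q'0; apply/polyP => -[|i]; rewrite coefC /= ?horner_coef0 //.
have /eqP := congr1 (fun r : {poly rat} => r`_i) q'0.
by rewrite coef_deriv coef0 mulrn_eq0 /= => /eqP.
Qed.

(* Each term is constant because the previous one vanishes, and that constant
   is the increment over [0, 1] of the next term, up to a nonzero factor. *)
Lemma appell_eq0 (D : nat -> {poly rat}) (a : nat -> rat) :
    D 0 = 0 ->
    (forall n, a n != 0) ->
    (forall n, (D n.+1)^`() = a n *: D n) ->
    (forall n, (D n.+2).[1] = (D n.+2).[0]) ->
  forall n, D n = 0.
Proof.
move=> D0 a0 D' D10; elim=> // n IHn.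
have Dn1 : D n.+1 = ((D n.+1).[0])%:P.
  by apply: deriv_eq0_rat; rewrite D' IHn scaler0.
set c := (D n.+1).[0] in Dn1 *.
have : (D n.+2 - (a n.+1 * c) *: 'X)^`() = 0.
  by rewrite derivB D' derivZ derivX Dn1 -mul_polyC -mul_polyC polyCM mulr1 subrr.
move/deriv_eq0_rat/(congr1 (fun q : {poly rat} => q.[1])).
rewrite hornerC !hornerE D10 => /eqP.
rewrite -subr_eq0 addrAC subrr sub0r oppr_eq0.
by rewrite mulf_eq0 (negPf (a0 _)) => /eqP c0; rewrite Dn1 c0.
Qed.

Definition bernpoly (n : nat) : {poly rat} :=
  \sum_(k < n.+1) ('C(n, k)%:R * bernoulli k) *: 'X^(n - k).

Lemma bernpoly_zero : bernpoly 0 = 1.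
Proof. by rewrite /bernpoly big_ord1 bin0 bernoulli0 mulr1 scale1r. Qed.

Lemma deriv_bernpoly n : (bernpoly n.+1)^`() = n.+1%:R *: bernpoly n.
Proof.
rewrite /bernpoly linear_sum big_ord_recr /= subnn derivZ derivC scaler0 addr0.
rewrite scaler_sumr; apply: eq_bigr => k _.
rewrite derivZ derivXn -scaler_nat !scalerA subSn -1?ltnS //=; congr (_ *: _).
rewrite mulrAC mulrA -!natrM; congr (_%:R * _).
by rewrite mulnC (mul_bin_down n.+1 k) subSn // -ltnS.
Qed.

Lemma bernpoly0 n : (bernpoly n).[0] = bernoulli n.
Proof.
rewrite /bernpoly horner_sum big_ord_recr /= subnn !hornerE binn mul1r.
rewrite big1 ?add0r // => k _; rewrite !hornerE expr0n subn_eq0 leqNgt ltn_ord.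
by rewrite mulr0.
Qed.

Lemma bernoulli1 : bernoulli 1 = - (1 / 2).
Proof.
have := @bernoulli_rec 1 isT.
by rewrite !big_nat_recr // big_geq //= bernoulli0 bin0 bin1 => E; lra.
Qed.

(** For n >= 2 the terms below the top one sum to zero by the defining recurrence; the correction at
    n = 1 reflects B_1 = -1/2. *)
Lemma bernpoly1 n : (bernpoly n).[1] = bernoulli n + (n == 1%N)%:R.
Proof.
case: n => [|[|n]]; first by rewrite /bernpoly big_ord_recr big_ord0 !hornerE.
  by rewrite /bernpoly !big_ord_recr big_ord0 !hornerE bernoulli1.
rewrite /bernpoly horner_sum big_ord_recr /= binn subnn !hornerE addrC.
rewrite (eq_bigr (fun k : 'I__ => 'C(n.+2, k)%:R * bernoulli k)); last first.
  by move=> k _; rewrite !hornerE expr1n mulr1.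
by have := @bernoulli_rec n.+1 isT; rewrite big_mkord => ->; rewrite addr0.
Qed.

(** By induction the two sides have equal derivatives, so they differ by a constant, which is read
    off at 0. *)
Lemma bernpoly_step n x :
  (bernpoly n.+1).[x + 1] - (bernpoly n.+1).[x] = n.+1%:R * x ^+ n.
Proof.
have shift q : (q \Po ('X + 1) : {poly rat}).[x] = q.[x + 1].
  by rewrite horner_comp !hornerE.
have E : bernpoly n.+1 \Po ('X + 1) - bernpoly n.+1 = n.+1%:R *: 'X^n.
  elim: n {x shift} => [|n IHn]; apply/eqP; rewrite -subr_eq0; apply/eqP;
    rewrite [LHS]deriv_eq0_rat ?derivB ?derivZ ?deriv_comp ?deriv_bernpoly.
  - rewrite !hornerE horner_comp !hornerE bernpoly0 bernpoly1.
    by rewrite [bernoulli 1 + _]addrC addrK subrr.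
  - rewrite derivXn mulr0n scaler0 subr0 derivD derivX derivC addr0 mulr1.
    by rewrite bernpoly_zero !scale1r comp_polyC subrr.
  - rewrite !hornerE horner_comp !hornerE bernpoly0 bernpoly1 expr0n /=.
    by rewrite addr0 subrr mulr0 subrr.
  - rewrite derivD derivX derivC addr0 mulr1 derivXn comp_polyZ -scalerBr IHn.
    by rewrite -!scaler_nat !scalerA mulrC subrr.
by rewrite -shift -hornerN -hornerD E !hornerE.
Qed.

(** The difference D_n of the two sides satisfies D_{n+1}' = -(n+1) D_n, and its values at 0 and 1
    agree for n >= 2, so [appell_eq0] applies. *)
Lemma bernpoly_reflect n :
  bernpoly n \Po (1 - 'X) = (-1) ^+ n *: bernpoly n.
Proof.
apply/eqP; rewrite -subr_eq0; apply/eqP; move: n.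
apply: (@appell_eq0 (fun n => bernpoly n \Po (1 - 'X) - (-1) ^+ n *: bernpoly n)
  (fun n => - n.+1%:R)) => [|n|n|n].
- by rewrite bernpoly_zero scale1r comp_polyC subrr.
- by rewrite oppr_eq0 pnatr_eq0.
- rewrite derivB derivZ deriv_comp !deriv_bernpoly derivB derivX derivC sub0r.
  rewrite comp_polyZ scalerBr !scalerA exprS mulrN1.
  by rewrite mulN1r !mulNr !scaleNr !opprK [_ * _%:R]mulrC.
- by rewrite !hornerE !horner_comp !hornerE subrr !bernpoly0 !bernpoly1 !addr0.
Qed.

Lemma bernoulli_odd n : odd n -> n != 1%N -> bernoulli n = 0.
Proof.
move=> n_odd n1; have := congr1 (fun q : {poly rat} => q.[0]) (bernpoly_reflect n).
rewrite horner_comp !hornerE bernpoly0 bernpoly1 (negPf n1) addr0.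
rewrite -signr_odd n_odd mulN1r => /eqP.
by rewrite -subr_eq0 opprK -mulr2n mulrn_eq0 /= => /eqP.
Qed.

Definition power_sum (m n : nat) : rat := \sum_(0 <= k < n) k%:R ^+ m.

(** Faulhaber's formula: [bernpoly_step] telescopes, and the constant term of [bernpoly m.+1]
    cancels. *)
Lemma power_sumE m n :
  power_sum m n = \sum_(0 <= r < m.+1)
    'C(m.+1, r)%:R / m.+1%:R * bernoulli r * n%:R ^+ (m.+1 - r).
Proof.
have m1 : m.+1%:R != 0 :> rat by rewrite pnatr_eq0.
transitivity (((bernpoly m.+1).[n%:R] - bernoulli m.+1) / m.+1%:R).
  rewrite /power_sum; elim: n => [|n IHn].
    by rewrite big_nil bernpoly0 subrr mul0r.
  rewrite big_nat_recr //= IHn -(mulKf m1 (n%:R ^+ m)) -bernpoly_step.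
  by rewrite -[n.+1%:R]natr1 [_^-1 * _]mulrC -mulrDl addrC addrA subrK.
rewrite /bernpoly horner_sum big_ord_recr /= subnn binn !hornerE addrK.
rewrite mulr_suml big_mkord; apply: eq_bigr => k _.
by rewrite !hornerE [LHS]mulrC !mulrA [_^-1 * _]mulrC.
Qed.

(** The polynomial form of Matiyasevich's identity. The weights 2 B_j + [j = 1] = B_j(0) + B_j(1)
    are chosen so that both sides have the same increment over [0, 1], as [appell_eq0] requires. *)
Lemma bernpoly_conv n :
  n.+2%:R *: \sum_(k < n.+1) bernpoly k * bernpoly (n - k) =
  \sum_(k < n.+1)
    ('C(n.+2, k)%:R * (2 * bernoulli (n - k) + (n - k == 1)%N%:R)) *: bernpoly k.
Proof.
pose P n := \sum_(k < n.+1) bernpoly k * bernpoly (n - k).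
pose c n : rat := 2 * bernoulli n + (n == 1)%N%:R.
pose Q n := \sum_(k < n.+1) ('C(n.+2, k)%:R * c (n - k)%N) *: bernpoly k.
have P' m : (P m.+1)^`() = m.+2%:R *: P m.
  rewrite /P linear_sum /=.
  under eq_bigr do rewrite derivM.
  rewrite big_split /= big_ord_recl /= bernpoly_zero derivC mul0r add0r.
  rewrite [X in _ + X]big_ord_recr /= subnn bernpoly_zero derivC mulr0 addr0.
  rewrite -big_split scaler_sumr; apply: eq_bigr => k _ /=.
  have lekm : (k <= m)%N by rewrite -ltnS.
  rewrite /bump /= add1n subSS subSn // !deriv_bernpoly -scalerAl -scalerAr -scalerDl.
  by rewrite -natrD addSn addnS subnKC.
have Q' m : (Q m.+1)^`() = m.+3%:R *: Q m.
  rewrite /Q linear_sum /= big_ord_recl bernpoly_zero derivZ derivC scaler0 add0r.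
  rewrite scaler_sumr; apply: eq_bigr => k _ /=.
  rewrite /bump /= add1n subSS derivZ deriv_bernpoly !scalerA; congr (_ *: _).
  rewrite mulrAC mulrA -!natrM; congr (_%:R * _).
  by rewrite mulnC -mul_bin_diag.
(* Among the factors B_k only B_1 changes between 0 and 1, by 1, so only k = 1 and k = m
   contribute. *)
have c10 m : (P m.+1).[1] - (P m.+1).[0] = c m.
  have delta (F : nat -> rat) : \sum_(k < m.+2) F k * (k == 1 :> nat)%:R = F 1%N.
    rewrite (bigD1 (@Ordinal m.+2 1 isT)) //= mulr1 big1 ?addr0 // => k.
    by rewrite -val_eqE => /negPf /= ->; rewrite mulr0.
  rewrite /P !horner_sum -sumrB.
  rewrite (eq_bigr (fun k : 'I_m.+2 =>
      (bernoulli (m.+1 - k) + (m.+1 - k == 1)%N%:R) * (k == 1 :> nat)%:R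
      + bernoulli k * (m.+1 - k == 1)%N%:R)); last first.
    by move=> k _; rewrite !hornerM !bernpoly0 !bernpoly1; ring.
  rewrite big_split /= (delta (fun k => bernoulli (m.+1 - k) + (m.+1 - k == 1)%N%:R)).
  rewrite (reindex_inj rev_ord_inj) /=.
  rewrite (eq_bigr (fun k : 'I_m.+2 => bernoulli (m.+1 - k) * (k == 1 :> nat)%:R)).
    by rewrite (delta (fun k => bernoulli (m.+1 - k))) !subSS subn0 /c; ring.
  by move=> k _; rewrite !subSS subKn // -ltnS.
have key m : m.+2%:R *: P m - Q m = 0.
  move: m; apply: (@appell_eq0 (fun m => m.+2%:R *: P m - Q m) (fun m => m.+3%:R)).
  - rewrite /P /Q !big_ord1 bernpoly_zero mulr1 /c subnn bernoulli0 bin0 mul1r.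
    by rewrite mulr1 addr0 subrr.
  - by move=> m; rewrite pnatr_eq0.
  - by move=> m; rewrite derivB derivZ P' Q' scalerBr !scalerA.
  - move=> m; apply/eqP; rewrite -subr_eq0 !hornerE.
    have Q1 : (Q m.+2).[1] - (Q m.+2).[0] = m.+4%:R * c m.+1.
      rewrite /Q !horner_sum -sumrB (bigD1 (@Ordinal m.+3 1 isT)) //= big1 => [|k].
        rewrite !hornerE bernpoly0 bernpoly1 bin1 subSS subn0.
        by rewrite mulrDr mulr1 addrAC subrr add0r.
      rewrite -val_eqE /= => /negPf k1.
      by rewrite !hornerE bernpoly0 bernpoly1 k1 addr0 subrr.
    have -> : forall a x y z t : rat, a * x - y - (a * z - t) = a * (x - z) - (y - t).
      by move=> *; ring.
    by rewrite Q1 c10 subrr.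
by apply/eqP; rewrite -subr_eq0; apply/eqP; apply: key.
Qed.

(** * Identities between Bernoulli numbers *)

(** The value of [bernpoly_conv] at 0. Its correction [n - k = 1] multiplies B_{n-1}, which vanishes
    because n - 1 is odd and differs from 1. *)
Lemma matiyasevich n : ~~ odd n -> n != 2%N ->
  n.+2%:R * \sum_(0 <= k < n.+1) bernoulli k * bernoulli (n - k) =
  2 * \sum_(0 <= k < n.+1) 'C(n.+2, k)%:R * (bernoulli k * bernoulli (n - k)).
Proof.
move=> n_even n2; have := congr1 (fun q : {poly rat} => q.[0]) (bernpoly_conv n).
rewrite !hornerE !horner_sum !big_mkord.
under eq_bigr do rewrite hornerM !bernpoly0.
move->; rewrite mulr_sumr; apply: eq_bigr => k _.
rewrite !hornerE bernpoly0.
case: (eqVneq (n - k)%N 1%N) => [nk1|_]; last by rewrite addr0 /=; ring.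
have -> : bernoulli k = 0 by apply: bernoulli_odd; lia.
by rewrite /= !(mulr0, mul0r).
Qed.

(** One of k and n - k is odd, so a term survives only if that index is 1; both survivors contain
    B_1 B_{n-1}. *)
Lemma bernoulli_conv_odd n (g : nat -> rat) : odd n ->
  \sum_(0 <= k < n.+1) g k * (bernoulli k * bernoulli (n - k)) =
  - (1 / 2) * (g 1%N + g n.-1) * bernoulli n.-1.
Proof.
move=> n_odd; have n_gt0 : (0 < n)%N by case: n n_odd.
have lt1 : (1 < n.+1)%N by [].
have ltn1 : (n.-1 < n.+1)%N by lia.
rewrite big_mkord (bigD1 (Ordinal lt1)) //= (bigD1 (Ordinal ltn1)) /=; last first.
  by rewrite -val_eqE /=; lia.
rewrite big1 ?addr0 => [|k /andP[]]; last first.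
  rewrite -!val_eqE /= => k1 kn; have := ltn_ord k.
  case: (boolP (odd k)) => k_odd ltk; first by rewrite bernoulli_odd // mul0r mulr0.
  by rewrite (@bernoulli_odd (n - k)) ?mulr0 //; lia.
have -> : (n - n.-1 = 1)%N by lia.
by rewrite bernoulli1 subn1; field.
Qed.

Lemma S_sum_odd n : odd n ->
  S_sum n = - (n.+1%:R * n.+2%:R / 4) * bernoulli n.-1.
Proof.
move=> n_odd; rewrite /S_sum.
under eq_bigr do rewrite -mulrA.
rewrite (bernoulli_conv_odd _ (fun r => 'C(n.+1, r)%:R)) // bin1.
have n_gt0 : (0 < n)%N by case: n n_odd.
have -> : 'C(n.+1, n.-1) = 'C(n.+1, 2) by rewrite -bin_sub; [congr 'C(_, _)|]; lia.
have -> : 'C(n.+1, 2)%:R = n.+1%:R * n%:R / 2 :> rat.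
  have := mul_bin_diag n.+1 1; rewrite bin1 /= => E.
  apply/(canRL (mulfK _)) => //.
  by rewrite -[RHS]natrM E natrM mulrC.
by rewrite -[n.+2%:R]natr1 -[n.+1%:R]natr1; field.
Qed.

(** Collects the order-p terms of the moments of H_k. *)
Definition S_double (m : nat) : rat :=
  \sum_(0 <= r < m.+1) 'C(m.+1, r)%:R / (m.+1 - r)%:R * bernoulli r * S_sum (m - r).

(** Collects the order-p terms of the power sums coming from 1 / k^2. *)
Definition conv_sum (m : nat) : rat :=
  \sum_(0 <= r < m) 'C(m.+1, r)%:R * (bernoulli r * bernoulli (m - 1 - r)).

(* Sum of k^m H_k^2 modulo p^2, before parity is taken into account. *)
Definition moment_value (p m : nat) : rat :=
  nu m - m%:R / 2 * bernoulli (m - 1)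
  + p%:R * (2 / (m%:R + 1) * S_double m + conv_sum m / (m%:R + 1)).

Lemma bernoulli2 : bernoulli 2 = 1 / 6.
Proof.
have := @bernoulli_rec 2 isT.
rewrite !big_nat_recr // big_geq //= bernoulli0 bernoulli1 bin0 bin1.
by rewrite (_ : 'C(3, 2) = 3%N); [move: (bernoulli 2) => b E; lra|].
Qed.

Lemma moment_value1 p : moment_value p 1 = bernoulli 0 + p%:R * mu 1.
Proof.
rewrite /moment_value /mu /nu /S_double /conv_sum /S_sum !big_nat_recr //= !big_geq //=.
rewrite ?(subSS, subn0, bin0, bin1, binn, bernoulli0, bernoulli1) /=; field; exact: isT.
Qed.

(** The cases m = 2 and m = 3 are computed directly: B_{m-1} = B_1 is nonzero for m = 2, and
    [matiyasevich] excludes m - 1 = 2. *)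
Lemma moment_value2 p : moment_value p 2 = 79 / 108 * p%:R - 4 / 9.
Proof.
rewrite /moment_value /nu /S_double /conv_sum /S_sum !big_nat_recr //= !big_geq //=.
rewrite ?(subSS, subn0, bin0, bin1, binn, bernoulli0, bernoulli1, bernoulli2).
rewrite (_ : 'C(3, 2) = 3%N); last by [].
by field.
Qed.

Lemma moment_value3 p : moment_value p 3 = - (59 / 144) * p%:R + 1 / 6.
Proof.
have B3 : bernoulli 3 = 0 by apply: bernoulli_odd.
rewrite /moment_value /nu /S_double /conv_sum /S_sum !big_nat_recr //= !big_geq //=.
rewrite ?(subSS, subn0, bin0, bin1, binn, bernoulli0, bernoulli1, bernoulli2, B3).
have [-> [-> ->]] : 'C(3, 2) = 3%N /\ 'C(4, 2) = 6%N /\ 'C(4, 3) = 4%N by [].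
by field.
Qed.

(** B_{m-1} vanishes and [conv_sum m], a convolution of odd total m - 1, collapses to a multiple of
    B_{m-2}: the last term of [lambda]. *)
Lemma moment_value_even p m : ~~ odd m -> (0 < m)%N -> m != 2%N ->
  moment_value p m = nu m + p%:R * lambda m.
Proof.
move=> m_even m_gt0 m2; rewrite /moment_value (@bernoulli_odd (m - 1)); [|lia|lia].
rewrite mulr0 subr0 /lambda -/(S_double m); congr (_ + _ * (_ + _)).
have [n Em] : exists n, m = n.+2 by exists m.-2; lia.
subst m.
have n_even : ~~ odd n by lia.
have -> : conv_sum n.+2 = - (1 / 2) * ('C(n.+3, 1)%:R + 'C(n.+3, 3)%:R) * bernoulli n.
  have binn3 : 'C(n.+3, n) = 'C(n.+3, 3).
    by have := @bin_sub (3 + n) 3 (leq_addr n 3); rewrite addKn add3n.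
  by rewrite /conv_sum subn1 (bernoulli_conv_odd _ (fun r => 'C(n.+3, r)%:R)) //= binn3.
have E : 6 * 'C(n.+3, 3)%:R = n.+3%:R * n.+2%:R * n.+1%:R :> rat.
  have E1 := mul_bin_diag n.+3 2; have E2 := mul_bin_diag n.+2 1.
  rewrite bin1 /= in E2; rewrite /= in E1.
  by rewrite -!natrM; congr _%:R; nia.
have -> : 'C(n.+3, 3)%:R = n.+3%:R * n.+2%:R * n.+1%:R / 6 :> rat by rewrite -E; field.
rewrite subn2 bin1 /= -[n.+3%:R]natr1 -[n.+2%:R]natr1 -[n.+1%:R]natr1; field.
by rewrite !natr1 pnatr_eq0.
Qed.

(** For even r the index m - r is odd, so [S_sum_odd] reduces the double sum to a single
    convolution; the only odd r left is 1. *)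
Lemma S_double_odd m : odd m -> (3 < m)%N ->
  S_double m = - (m.+1%:R / (2 * m%:R)) * S_sum m.-1
    - (conv_sum m + m.+1%:R * S_sum m.-1) / 4.
Proof.
move=> m_odd m3.
(* Split m + 2 - r = 1 + (m + 1 - r) and use C(m+1, r) (m + 1 - r) = (m + 1) C(m, r). *)
have -> : conv_sum m + m.+1%:R * S_sum m.-1 = \sum_(0 <= r < m)
    'C(m.+1, r)%:R * (m.+2 - r)%:R * (bernoulli r * bernoulli (m - 1 - r)).
  rewrite /conv_sum /S_sum prednK; last lia.
  rewrite mulr_sumr -big_split /=; apply: eq_big_nat => r /andP[_ ltrm].
  rewrite !subn1.
  rewrite !mulrA -natrM (mul_bin_down m.+1 r) natrM.
  rewrite (_ : m.+2 - r = (m.+1 - r).+1)%N; last lia.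
  by rewrite -natr1; ring.
rewrite /S_double big_nat_recr //= (@bernoulli_odd m); [|lia|lia].
rewrite mulr0 mul0r addr0 !big_mkord.
have lt1 : (1 < m)%N by lia.
(* On the right the term r = 1 contains B_{m-2}, which is zero since m > 3. *)
rewrite (bigD1 (Ordinal lt1)) // [in RHS](bigD1 (Ordinal lt1)) //=.
rewrite (@bernoulli_odd (m - 1 - 1)); [|lia|lia].
rewrite !mulr0 add0r bin1 subn1 /=; congr (_ + _).
  by rewrite bernoulli1 subn1; field; rewrite pnatr_eq0; lia.
rewrite mulr_suml -sumrN; apply: eq_bigr => r; rewrite -val_eqE /= => r1.
have [r_odd|r_even] := boolP (odd r).
  by rewrite (@bernoulli_odd r) // !(mulr0, mul0r) oppr0.
have ltrm := ltn_ord r.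
rewrite S_sum_odd; last lia.
have -> : (m - r).-1 = (m - 1 - r)%N by lia.
have -> : (m - r).+1 = (m.+1 - r)%N by lia.
have -> : (m.+1 - r).+1 = (m.+2 - r)%N by lia.
field; rewrite pnatr_eq0; lia.
Qed.

(** By [S_sum_odd] the constant term is ((m + 2)/2 - m/2) B_{m-1}. For m > 1, [S_double_odd] leaves
    [conv_sum m] in the order-p term, and [matiyasevich] at m - 1 removes its binomials. *)
Lemma moment_value_odd p m : odd m -> m != 3%N ->
  moment_value p m = bernoulli (m - 1) + p%:R * mu m.
Proof.
move=> m_odd m3.
have [->|m1] := eqVneq m 1%N; first exact: moment_value1.
have [n Em] : exists n, m = n.+1 by exists m.-1; lia.
rewrite /moment_value /mu /nu S_double_odd //; last lia.
rewrite (@S_sum_odd m) //.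
rewrite {m}Em in m_odd m1 m3 *; rewrite subn1 /=.
have n_even : ~~ odd n by lia.
have n2 : n != 2%N by lia.
have := matiyasevich n n_even n2.
rewrite /conv_sum subn1 /=.
set a := \sum_(0 <= k < n.+1) 'C(_, _)%:R * _.
set b := \sum_(0 <= k < n.+1) _ => E.
have -> : a = n.+2%:R / 2 * b by apply: (mulfI (_ : 2 != 0)); rewrite // -E; field.
rewrite -[n.+3%:R]natr1 -[n.+2%:R]natr1 -[n.+1%:R]natr1; field.
by rewrite !natr1 !pnatr_eq0.
Qed.

(** * The local ring of p-integral rationals *)

Definition Zloc (p : nat) : {pred rat} := fun x => coprimez p (denq x).

(** The reduced denominator is coprime to the numerator, hence divides b by Gauss's lemma. *)
Lemma Zloc_frac (p : nat) (a b : int) : coprimez p b -> a%:~R / b%:~R \in Zloc p.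
Proof.
rewrite unfold_in /Zloc => cpb.
have [->|b0] := eqVneq b 0; first by rewrite invr0 mulr0 coprimezE coprimen1.
apply: coprimez_dvdr cpb; suff: (denq (a%:~R / b%:~R : rat) %| b)%Z by [].
set x := _ / _; have xb : numq x * b = a * denq x.
  apply: (@intr_inj rat); rewrite !intrM numqE /x mulrAC divfK ?intr_eq0 //.
rewrite -(@Gauss_dvdzr _ (numq x)); last by rewrite coprimezE coprime_sym coprime_num_den.
by rewrite xb dvdz_mull.
Qed.

Lemma Zloc_subring p : subring_closed (Zloc p).
Proof.
have d0 (x : rat) : (denq x)%:~R != 0 :> rat by rewrite intr_eq0 denq_neq0.
split=> [|x y xp yp|x y xp yp]; first by rewrite unfold_in /Zloc coprimezE coprimen1.
  have -> : x - y = (numq x * denq y - numq y * denq x)%:~R / (denq x * denq y)%:~R.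
    rewrite -[x in LHS]divq_num_den -[y in LHS]divq_num_den !(intrM, intrB).
    by field; rewrite !d0.
  by apply: Zloc_frac; rewrite coprimezMr; apply/andP.
have -> : x * y = (numq x * numq y)%:~R / (denq x * denq y)%:~R.
  by rewrite -[x in LHS]divq_num_den -[y in LHS]divq_num_den !intrM; field; rewrite !d0.
by apply: Zloc_frac; rewrite coprimezMr; apply/andP.
Qed.
HB.instance Definition _ p := GRing.isSubringClosed.Build rat (Zloc p) (Zloc_subring p).

Lemma Zloc_nat p n : n%:R \in Zloc p.
Proof. exact: rpred_nat. Qed.

(** For p > 0 this is the ideal p^e Z_(p); congruences become memberships, stable under sums and
    p-integral multiples. *)
Definition pideal (p e : nat) : {pred rat} := fun x => x / (p ^ e)%:R \in Zloc p.

Lemma pidealE p e x : (x \in pideal p e) = (x / (p ^ e)%:R \in Zloc p).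
Proof. by []. Qed.

Lemma pideal_zmod p e : zmod_closed (pideal p e).
Proof.
split=> [|x y xp yp]; first by rewrite pidealE mul0r rpred0.
by rewrite pidealE mulrBl rpredB.
Qed.
HB.instance Definition _ p e :=
  GRing.isZmodClosed.Build rat (pideal p e) (pideal_zmod p e).

Lemma pidealM p e a x : a \in Zloc p -> x \in pideal p e -> a * x \in pideal p e.
Proof. by move=> ap xp; rewrite pidealE -mulrA rpredM. Qed.

Lemma pideal_pow p e x : (0 < p)%N -> x \in Zloc p -> (p ^ e)%:R * x \in pideal p e.
Proof.
move=> p0 xp; rewrite pidealE mulrAC divff ?mul1r //.
by rewrite pnatr_eq0 -lt0n expn_gt0 p0.
Qed.

Lemma pideal1 p x : (0 < p)%N -> x \in Zloc p -> p%:R * x \in pideal p 1.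
Proof. by rewrite -[p in p%:R]expn1; exact: pideal_pow. Qed.

Lemma pideal2 p x : (0 < p)%N -> x \in pideal p 1 -> p%:R * x \in pideal p 2.
Proof.
move=> p0 xp; rewrite pidealE expnS natrM invfM mulrACA divff ?mul1r //.
by rewrite pnatr_eq0 -lt0n.
Qed.

Lemma pideal21 p x : x \in pideal p 2 -> x \in pideal p 1.
Proof.
have [->|p0] := posnP p; first by rewrite !pidealE !exp0n.
rewrite !pidealE => xp.
have -> : x / (p ^ 1)%:R = p%:R * (x / (p ^ 2)%:R).
  by rewrite expn1 -mulnn natrM; field; rewrite pnatr_eq0 -lt0n.
by rewrite rpredM ?Zloc_nat.
Qed.

Lemma eqmodr_pideal p e a b :
  (0 < p)%N -> a \in Zloc p -> a - b \in pideal p e -> eqmodr p e a b.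
Proof.
move=> p0 ap abp.
have pe0 : (p ^ e)%:R != 0 :> rat by rewrite pnatr_eq0 -lt0n expn_gt0 p0.
have bp : b \in Zloc p.
  rewrite -(subKr a b) rpredB // -(divfK pe0 (a - b)) rpredM ?Zloc_nat //.
apply/and3P; split=> //; set c := a - b in abp *.
(* Denominators are cleared in c = p^e (c / p^e); the denominator of the quotient is coprime to p,
   so p^e divides [numq c]. *)
have E : numq c * denq (c / (p ^ e)%:R) = (p ^ e)%N%:Z * numq (c / (p ^ e)%:R) * denq c.
  apply: (@intr_inj rat); rewrite !intrM !numqE /=.
  rewrite [(p ^ e)%N%:Z%:~R]/((p ^ e)%:R) mulrA [_%:R * (_ / _)]mulrC divfK //.
  by rewrite mulrAC.
rewrite -(@Gauss_dvdzl _ _ (denq (c / (p ^ e)%:R))); last first.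
  by rewrite coprimezE /= coprimeXl.
by rewrite E -mulrA dvdz_mulr.
Qed.

Lemma Zloc_inv p k : prime p -> (0 < k < p)%N -> k%:R^-1 \in Zloc p.
Proof.
move=> pp /andP[k0 kp]; rewrite -[k%:R^-1]mul1r; apply: (@Zloc_frac p 1 k).
rewrite coprimezE /= prime_coprime //; apply/negP => /(dvdn_leq k0).
by rewrite leqNgt kp.
Qed.

(** Solving the recurrence for B_r divides only by r + 1, which is less than p. *)
Lemma Zloc_bernoulli p r : prime p -> (r < p.-1)%N -> bernoulli r \in Zloc p.
Proof.
move=> pp; elim/ltn_ind: r => -[|r] IH ltr; first by rewrite bernoulli0 rpred1.
have r2 : r.+2%:R != 0 :> rat by rewrite pnatr_eq0.
have := @bernoulli_rec r.+1 isT; rewrite big_nat_recr //= binSn => /eqP.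
rewrite addrC addr_eq0 => /eqP /(canRL (mulKf r2)) ->.
apply: rpredM; first by apply: Zloc_inv => //; lia.
rewrite rpredN big_seq; apply: rpred_sum => k; rewrite mem_index_iota => /andP[_ kr].
by apply: rpredM; [exact: Zloc_nat|apply: IH; lia].
Qed.

(** * Power sums modulo p^2 and Wolstenholme's congruence *)

Definition unit_power_sum (p i : nat) : rat := \sum_(1 <= k < p) k%:R ^+ i.

Lemma unit_power_sum_mod p i : prime p -> (i < p.-1)%N ->
  unit_power_sum p i - (p%:R * bernoulli i - (i == 0)%N%:R) \in pideal p 2.
Proof.
move=> pp ip; have p0 := prime_gt0 pp.
(* The term k = 0 of [power_sum] is 0^i, equal to 1 when i = 0. *)
have -> : unit_power_sum p i = power_sum i p - (i == 0)%N%:R.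
  rewrite /power_sum big_ltn // expr0n /unit_power_sum; ring.
have i1 : i.+1%:R != 0 :> rat by rewrite pnatr_eq0.
rewrite power_sumE big_nat_recr //= subSnn expr1 binSn divff // mul1r.
set s := (X in X + _ - _).
have -> : forall z t u : rat, z + t * p%:R - u - (p%:R * t - u) = z.
  by move=> *; ring.
rewrite /s big_seq; apply: rpred_sum => r; rewrite mem_index_iota => /andP[_ ri].
have -> : (i.+1 - r = 2 + (i - r.+1))%N by lia.
rewrite exprD -natrX mulrCA; apply: pideal_pow => //.
rewrite !rpredM ?rpredX ?Zloc_nat ?Zloc_bernoulli ?Zloc_inv //; lia.
Qed.

Lemma fermat_pideal p k : prime p -> (0 < k < p)%N -> k%:R ^+ p.-1 - 1 \in pideal p 1.
Proof.
move=> pp /andP[k0 kp].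
have: (p %| k ^ p.-1 - 1)%N.
  rewrite -(@Gauss_dvdr _ k); last first.
    by rewrite prime_coprime //; apply/negP => /(dvdn_leq k0); rewrite leqNgt kp.
  rewrite mulnBr muln1 -expnS prednK ?prime_gt0 //.
  by rewrite -eqn_mod_dvd ?fermat_little // -{1}(expn1 k) leq_pexp2l // prime_gt0.
move=> /dvdnP[q Eq]; have -> : k%:R ^+ p.-1 - 1 = p%:R * q%:R :> rat.
  by rewrite -natrM mulnC -Eq natrB ?natrX // expn_gt0 k0.
by apply: pideal1; [exact: prime_gt0|exact: Zloc_nat].
Qed.

Lemma wolstenholme p : prime p -> (3 < p)%N -> harmonic p.-1 \in pideal p 2.
Proof.
move=> pp p3; have p0 := prime_gt0 pp.
(* By Fermat 1 / k^2 is congruent to k^(p-3), and the sum of these powers to p B_{p-3}. *)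
have sq : \sum_(1 <= k < p) (k%:R^-1 ^+ 2) \in pideal p 1.
  have -> : \sum_(1 <= k < p) (k%:R^-1 ^+ 2) = unit_power_sum p (p - 3)
      - \sum_(1 <= k < p) k%:R^-1 ^+ 2 * (k%:R ^+ p.-1 - 1) :> rat.
    rewrite /unit_power_sum -sumrB; apply: eq_big_nat => k /andP[k0 kp].
    have -> : p.-1 = (2 + (p - 3))%N by lia.
    by rewrite exprD; field; rewrite pnatr_eq0; lia.
  apply: rpredB.
    have /pideal21 h : unit_power_sum p (p - 3)
        - (p%:R * bernoulli (p - 3) - (p - 3 == 0)%N%:R) \in pideal p 2.
      by apply: unit_power_sum_mod => //; lia.
    rewrite -(subrK (p%:R * bernoulli (p - 3) - (p - 3 == 0)%N%:R) (unit_power_sum _ _)).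
    apply: rpredD => //; rewrite (_ : (p - 3 == 0)%N = false) ?subr0; last lia.
    by apply: pideal1 => //; apply: Zloc_bernoulli => //; lia.
  rewrite big_seq; apply: rpred_sum => k; rewrite mem_index_iota => kp.
  by apply: pidealM; [apply/rpredX/Zloc_inv | apply: fermat_pideal].
(* Pair k with p - k: 1/k + 1/(p-k) = -p/k^2 + p^2/(k^2 (p-k)). *)
have -> : harmonic p.-1 = 2^-1 * (- (p%:R * \sum_(1 <= k < p) (k%:R^-1 ^+ 2))
   + (p ^ 2)%:R * \sum_(1 <= k < p) (k%:R^-1 ^+ 2 * (p - k)%:R^-1)).
  have Hr : harmonic p.-1 = \sum_(1 <= k < p) (p - k)%:R^-1.
    rewrite /harmonic prednK // big_nat_rev /=; apply: eq_big_nat => k kp.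
    by congr (_%:R^-1); lia.
  have : 2 * harmonic p.-1 = \sum_(1 <= k < p) (k%:R^-1 + (p - k)%:R^-1).
    by rewrite big_split /= -Hr /harmonic prednK //; ring.
  move/(canRL (mulKf (_ : 2 != 0))) => -> //; congr (_ * _).
  rewrite !mulr_sumr -sumrN -big_split /=; apply: eq_big_nat => k kp.
  by rewrite natrX natrB; [field; rewrite -natrB ?pnatr_eq0; lia|lia].
apply: pidealM; first by apply: Zloc_inv => //; lia.
apply: rpredD; first by rewrite rpredN; apply: pideal2.
apply: pideal_pow => //; rewrite big_seq; apply: rpred_sum => k.
by rewrite mem_index_iota => kp; rewrite rpredM ?rpredX ?Zloc_inv //; lia.
Qed.

(** * Moments of harmonic numbers *)

(** Partial sums start at i = 0 to match [power_sum]; the extra f(0) cancels because h(0) = 0. *)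
Lemma abel_summation (f h : nat -> rat) n : h 0%N = 0 ->
  \sum_(1 <= k < n.+1) f k * h k =
  (\sum_(0 <= i < n.+1) f i) * h n
  - \sum_(1 <= k < n.+1) (\sum_(0 <= i < k) f i) * (h k - h k.-1).
Proof.
move=> h0; elim: n => [|n IHn]; first by rewrite !(@big_geq _ _ _ 1 1) // h0 mulr0 subr0.
rewrite big_nat_recr //= IHn [in RHS](@big_nat_recr _ _ _ n.+1 1) //=.
by rewrite (@big_nat_recr _ _ _ n.+1 0) //=; ring.
Qed.

Lemma harmonic0 : harmonic 0 = 0.
Proof. by rewrite /harmonic big_geq. Qed.

Lemma Zloc_harmonic p k : prime p -> (k < p)%N -> harmonic k \in Zloc p.
Proof.
move=> pp kp; rewrite /harmonic big_seq; apply: rpred_sum => i.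
by rewrite mem_index_iota => ik; apply: Zloc_inv => //; lia.
Qed.

Lemma harmonicB k : (0 < k)%N -> harmonic k - harmonic k.-1 = k%:R^-1.
Proof.
by case: k => // k _; rewrite /harmonic big_nat_recr //= addrAC subrr add0r.
Qed.

(** The coefficient of n^(m+1-r) in [power_sum m n]. *)
Definition faulhaber (m r : nat) : rat := 'C(m.+1, r)%:R / m.+1%:R * bernoulli r.

Lemma Zloc_faulhaber p m r : prime p -> (r <= m < p.-1)%N -> faulhaber m r \in Zloc p.
Proof.
move=> pp rm; rewrite !rpredM ?Zloc_nat ?Zloc_bernoulli ?Zloc_inv //; lia.
Qed.

Lemma power_sum_div m k : (0 < k)%N ->
  power_sum m k / k%:R = \sum_(0 <= r < m.+1) faulhaber m r * k%:R ^+ (m - r).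
Proof.
move=> k0; rewrite power_sumE mulr_suml; apply: eq_big_nat => r /andP[_ rm].
by rewrite subSn // exprSr mulrA mulfK // pnatr_eq0 -lt0n.
Qed.

Lemma Zloc_power_sum p m n : power_sum m n \in Zloc p.
Proof. by apply: rpred_sum => k _; rewrite rpredX ?Zloc_nat. Qed.

Definition harmonic_moment (p j : nat) : rat :=
  \sum_(1 <= k < p) k%:R ^+ j * harmonic k.

Lemma harmonic_moment_mod p j : prime p -> (3 < p)%N -> (j < p.-1)%N ->
  harmonic_moment p j - (bernoulli j - p%:R * S_sum j / j.+1%:R) \in pideal p 2.
Proof.
move=> pp p3 jp; have p0 := prime_gt0 pp.
pose v i : rat := p%:R * bernoulli i - (i == 0)%N%:R.
(* Here v i is the residue of [unit_power_sum p i]; its part -[i = 0] selects r = j, where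
   [faulhaber j j] is B_j. *)
have -> : bernoulli j - p%:R * S_sum j / j.+1%:R =
    - \sum_(0 <= r < j.+1) faulhaber j r * v (j - r)%N.
  have j1 : j.+1%:R != 0 :> rat by rewrite pnatr_eq0.
  have -> : \sum_(0 <= r < j.+1) faulhaber j r * v (j - r)%N =
     p%:R * S_sum j / j.+1%:R - \sum_(0 <= r < j.+1) faulhaber j r * (j - r == 0)%N%:R.
    rewrite /S_sum mulrAC mulr_sumr -sumrB; apply: eq_bigr => r _.
    by rewrite /faulhaber /v; move: (_^-1) => y; ring.
  rewrite big_nat_recr //= subnn mulr1 big_nat big1 => [|r rj].
    by rewrite /faulhaber binSn divff //; ring.
  by rewrite (_ : (j - r == 0)%N = false) ?mulr0 //; lia.
have -> : harmonic_moment p j = power_sum j p * harmonic p.-1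
    - \sum_(0 <= r < j.+1) faulhaber j r * unit_power_sum p (j - r).
  rewrite /harmonic_moment -{1}(prednK p0) abel_summation ?harmonic0 // prednK //.
  congr (_ - _); rewrite /unit_power_sum.
  under [RHS]eq_bigr do rewrite mulr_sumr.
  rewrite exchange_big_nat /=; apply: eq_big_nat => k /andP[k0 _].
  by rewrite harmonicB // power_sum_div.
rewrite opprK -addrA [- _ + _]addrC -opprB; apply: rpredB.
  by apply: pidealM; [exact: Zloc_power_sum|exact: wolstenholme].
rewrite -sumrB big_seq; apply: rpred_sum => r; rewrite mem_index_iota => rj.
rewrite -mulrBr; apply: pidealM; first by apply: Zloc_faulhaber => //; lia.
by apply: unit_power_sum_mod => //; lia.
Qed.

(** * Moments of squared harmonic numbers *)

Definition harmonic2_moment (p m : nat) : rat :=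
  \sum_(1 <= k < p) k%:R ^+ m * harmonic k ^+ 2.

(** The residue modulo p^2 of the sum of k^(i-1); the value 0 at i = 0 is Wolstenholme's
    congruence. *)
Definition quot_val (p i : nat) : rat :=
  if i is j.+1 then p%:R * bernoulli j - (j == 0)%N%:R else 0.

Lemma quot_power_sum_mod p i : prime p -> (3 < p)%N -> (i < p.-1)%N ->
  \sum_(1 <= k < p) k%:R ^+ i / k%:R - quot_val p i \in pideal p 2.
Proof.
move=> pp p3; have p0 := prime_gt0 pp; case: i => [|i] ip /=.
  under eq_bigr do rewrite expr0 mul1r.
  by have := wolstenholme p pp p3; rewrite subr0 /harmonic prednK.
have -> : \sum_(1 <= k < p) k%:R ^+ i.+1 / k%:R = unit_power_sum p i.
  apply: eq_big_nat => k /andP[k0 _].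
  by rewrite exprSr mulfK // pnatr_eq0 -lt0n.
by apply: unit_power_sum_mod => //; lia.
Qed.

(** Rewrites the closed form as summation by parts produces it, so that the two can be compared term
    by term in r. *)
Lemma moment_value_faulhaber p m : (0 < m)%N ->
  moment_value p m = - \sum_(0 <= r < m.+1) faulhaber m r *
    (2 * (bernoulli (m - r) - p%:R * S_sum (m - r) / (m - r).+1%:R)
     - quot_val p (m - r)).
Proof.
move=> m0; have m1 : m.+1%:R != 0 :> rat by rewrite pnatr_eq0.
have -> : \sum_(0 <= r < m.+1) faulhaber m r *
    (2 * (bernoulli (m - r) - p%:R * S_sum (m - r) / (m - r).+1%:R)
     - quot_val p (m - r)) =
    2 / m.+1%:R * S_sum m - 2 * p%:R / m.+1%:R * S_double m
    - \sum_(0 <= r < m.+1) faulhaber m r * quot_val p (m - r).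
  rewrite [S_sum m]/S_sum /S_double !mulr_sumr -!sumrB; apply: eq_big_nat => r /andP[_ rm].
  rewrite -subSn // /faulhaber.
  by move: (m.+1%:R^-1) ((m.+1 - r)%:R^-1) => y z; ring.
have -> : \sum_(0 <= r < m.+1) faulhaber m r * quot_val p (m - r) =
    p%:R / m.+1%:R * conv_sum m - m%:R / 2 * bernoulli (m - 1).
  rewrite big_nat_recr //= subnn mulr0 addr0.
  have [n En] : exists n, m = n.+1 by exists m.-1; lia.
  subst m; rewrite /conv_sum subn1 /=.
  (* Only r = n survives, and C(n+2, n) / (n+2) = (n+1)/2. *)
  have -> : n.+1%:R / 2 * bernoulli n = \sum_(0 <= r < n.+1)
     faulhaber n.+1 r * (n - r == 0)%N%:R.
    rewrite big_nat_recr //= subnn mulr1 big_nat big1 => [|r rn].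
      have E : 2 * 'C(n.+2, n)%:R = n.+2%:R * n.+1%:R :> rat.
        have -> : 'C(n.+2, n) = 'C(n.+2, 2).
          by have := @bin_sub (2 + n) 2 (leq_addr n 2); rewrite addKn add2n.
        by rewrite -!natrM -(mul_bin_diag n.+2 1) bin1.
      rewrite add0r /faulhaber.
      have -> : 'C(n.+2, n)%:R = n.+2%:R * n.+1%:R / 2 :> rat by rewrite -E mulrC mulKf.
      by field; rewrite -natrD pnatr_eq0.
    by rewrite (_ : (n - r == 0)%N = false) ?mulr0 //; lia.
  rewrite mulr_sumr -sumrB; apply: eq_big_nat => r /andP[_ rn].
  rewrite subSn //= /faulhaber; move: (_^-1) => y; ring.
rewrite /moment_value /nu natr1; field.
by rewrite nat1r.
Qed.

Lemma harmonic2_moment_mod p m : prime p -> (3 < p)%N -> (0 < m < p.-1)%N ->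
  harmonic2_moment p m - moment_value p m \in pideal p 2.
Proof.
move=> pp p3 /andP[m0 mp]; have p0 := prime_gt0 pp.
rewrite moment_value_faulhaber // opprK.
have -> : harmonic2_moment p m = power_sum m p * harmonic p.-1 * harmonic p.-1
    - \sum_(0 <= r < m.+1) faulhaber m r * (2 * harmonic_moment p (m - r)
        - \sum_(1 <= k < p) k%:R ^+ (m - r) / k%:R).
  rewrite /harmonic2_moment -{1}(prednK p0).
  rewrite (abel_summation _ (fun k => harmonic k ^+ 2)) ?harmonic0 // prednK //.
  rewrite -mulrA; congr (_ - _); rewrite /harmonic_moment.
  under [RHS]eq_bigr do rewrite mulr_sumr -sumrB mulr_sumr.
  rewrite exchange_big_nat /=; apply: eq_big_nat => k /andP[k0 _].
  have -> : harmonic k.-1 = harmonic k - k%:R^-1 by rewrite -harmonicB //; ring.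
  rewrite -/(power_sum m k).
  (* The factor 1 / k is absorbed by [power_sum m k], a polynomial in k without constant term. *)
  have -> : harmonic k ^+ 2 - (harmonic k - k%:R^-1) ^+ 2 =
     k%:R^-1 * (2 * harmonic k - k%:R^-1) by ring.
  rewrite mulrA power_sum_div // mulr_suml; apply: eq_bigr => r _.
  by move: (_^-1) => y; ring.
rewrite -addrA [- _ + _]addrC -opprB; apply: rpredB.
  apply: pidealM; last exact: wolstenholme.
  by rewrite rpredM ?Zloc_power_sum ?Zloc_harmonic // prednK.
rewrite -sumrB big_seq; apply: rpred_sum => r; rewrite mem_index_iota => rm.
rewrite -mulrBr; apply: pidealM; first by apply: Zloc_faulhaber => //; lia.
have -> : forall a b c d : rat, 2 * a - b - (2 * c - d) = 2 * (a - c) - (b - d).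
  by move=> *; ring.
apply: rpredB; last by apply: quot_power_sum_mod => //; lia.
by apply: pidealM; [exact: Zloc_nat|apply: harmonic_moment_mod => //; lia].
Qed.

Theorem theorem3p2 (p : nat) (p_prime : prime p) (p_gt3 : (3 < p)%N) :
  [/\ eqmodr p 2 (\sum_(1 <= k < p) k%:R ^+ 2 * harmonic k ^+ 2)
        (79 / 108 * p%:R - 4 / 9),
      eqmodr p 2 (\sum_(1 <= k < p) k%:R ^+ 3 * harmonic k ^+ 2)
        (- (59 / 144) * p%:R + 1 / 6)
    & forall m : nat, (0 < m < p - 1)%N ->
      (odd m -> m <> 3%N ->
         eqmodr p 2 (\sum_(1 <= k < p) k%:R ^+ m * harmonic k ^+ 2)
           (bernoulli (m - 1) + p%:R * mu m)) /\
      (~~ odd m -> m <> 2%N ->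
         eqmodr p 2 (\sum_(1 <= k < p) k%:R ^+ m * harmonic k ^+ 2)
           (nu m + p%:R * lambda m))].
Proof.
have key m : (0 < m < p.-1)%N -> eqmodr p 2 (harmonic2_moment p m) (moment_value p m).
  move=> mp; apply: eqmodr_pideal; [exact: prime_gt0| |exact: harmonic2_moment_mod].
  rewrite /harmonic2_moment big_seq; apply: rpred_sum => k; rewrite mem_index_iota => kp.
  by rewrite rpredM ?rpredX ?Zloc_nat ?Zloc_harmonic //; lia.
(* Hence p >= 5, so that m = 3 satisfies m < p - 1. *)
have p4 : p != 4%N by apply: contraL p_prime => /eqP ->.
split=> [||m mp].
- by rewrite -moment_value2; apply: key; lia.
- by rewrite -moment_value3; apply: key; lia.
rewrite subn1 in mp; split=> m_par m_neq; rewrite -/(harmonic2_moment p m).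
  by rewrite -moment_value_odd ?key //; lia.
by rewrite -moment_value_even ?key //; lia.
Qed.
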